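(* Let $X$ be a topological space homeomorphic to a $G_\delta$ subset (with the subspace topology) of a locally compact sober space $Y$, i.e. $X$ is LCS-complete. Then every continuous valuation $\nu$ on $X$ extends to a measure $\mu$ on $X$ with its Borel $\sigma$-algebra, i.e. $\mu(U)=\nu(U)$ for every open subset $U$ of $X$.
   Context: A $G_\delta$ subset of a space is an intersection of countably many open subsets. Compactness does not presuppose any separation axiom. A space is locally compact if every point has a neighborhood base of compact saturated sets (saturated = upward closed in the specialization preorder, equivalently intersection of its open neighborhoods); it is sober if every irreducible closed subset is the closure of a unique point. A continuous valuation on a space $X$ is a map $\nu$ from the lattice $\mathcal O X$ of open subsets of $X$ to $[0,\infty]$ that is strict ($\nu(\emptyset)=0$), modular ($\nu(U)+\nu(V)=\nu(U\cup V)+\nu(U\cap V)$), and Scott-continuous (preserves suprema of directed families of open sets). No local finiteness or boundedness is assumed. A measure is a countably additive map from the Borel $\sigma$-algebra to $[0,\infty]$. *)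

(* Defs.v *)
From Stdlib Require Import Reals List.
Open Scope R_scope.
Set Implicit Arguments.

Record topology (X : Type) := Topology {
  open : (X -> Prop) -> Prop;
  open_full : open (fun _ => True);
  open_inter : forall U V, open U -> open V -> open (fun x => U x /\ V x);
  open_union : forall F : (X -> Prop) -> Prop,
      (forall U, F U -> open U) -> open (fun x => exists U, F U /\ U x)
}.
Arguments open {X} t _.

Section Topo.
Context {X : Type} (T : topology X).

Definition closed (C : X -> Prop) : Prop := open T (fun x => ~ C x).

Definition closure (A : X -> Prop) : X -> Prop :=
  fun x => forall U, open T U -> U x -> exists y, U y /\ A y.

(** specialization preorder: x <= y iff x is in the closure of {y} *)
Definition spec_le (x y : X) : Prop := forall U, open T U -> U x -> U y.

Definition saturated (K : X -> Prop) : Prop :=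
  forall x y, K x -> spec_le x y -> K y.

Definition compact (K : X -> Prop) : Prop :=
  forall F : (X -> Prop) -> Prop,
    (forall U, F U -> open T U) ->
    (forall x, K x -> exists U, F U /\ U x) ->
    exists l : list (X -> Prop),
      (forall U, In U l -> F U) /\ (forall x, K x -> exists U, In U l /\ U x).

Definition locally_compact : Prop :=
  forall x U, open T U -> U x ->
    exists K V, open T V /\ V x /\ (forall y, V y -> K y) /\
                (forall y, K y -> U y) /\ compact K /\ saturated K.

Definition irreducible (C : X -> Prop) : Prop :=
  (exists x, C x) /\
  forall A B, closed A -> closed B -> (forall x, C x -> A x \/ B x) ->
    (forall x, C x -> A x) \/ (forall x, C x -> B x).

Definition sober : Prop :=
  forall C, closed C -> irreducible C ->
    exists x, (forall z, C z <-> closure (fun y => y = x) z) /\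
      forall x', (forall z, C z <-> closure (fun y => y = x') z) -> x' = x.

Definition G_delta (A : X -> Prop) : Prop :=
  exists Un : nat -> X -> Prop, (forall n, open T (Un n)) /\
    forall x, A x <-> forall n, Un n x.

End Topo.

Definition continuous {X Y : Type} (TX : topology X) (TY : topology Y)
  (f : X -> Y) : Prop :=
  forall V, open TY V -> open TX (fun x => V (f x)).

Definition homeomorphic {X Y : Type} (TX : topology X) (TY : topology Y) : Prop :=
  exists (f : X -> Y) (g : Y -> X),
    (forall x, g (f x) = x) /\ (forall y, f (g y) = y) /\
    continuous TX TY f /\ continuous TY TX g.

Section Subspace.
Context {Y : Type} (T : topology Y) (A : Y -> Prop).

Definition sub_open (W : {y | A y} -> Prop) : Prop :=
  exists U, open T U /\ forall z, W z <-> U (proj1_sig z).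

Lemma sub_open_full : sub_open (fun _ => True).
Proof. exists (fun _ => True); split; [apply open_full | tauto]. Qed.

Lemma sub_open_inter : forall U V, sub_open U -> sub_open V ->
  sub_open (fun x => U x /\ V x).
Proof.
  intros U V [U' [HU EU]] [V' [HV EV]].
  exists (fun y => U' y /\ V' y); split; [apply open_inter; auto|].
  intro z; rewrite EU, EV; tauto.
Qed.

Lemma sub_open_union : forall F : ({y | A y} -> Prop) -> Prop,
  (forall U, F U -> sub_open U) -> sub_open (fun x => exists U, F U /\ U x).
Proof.
  intros F HF.
  exists (fun y => exists U, (open T U /\ exists W, F W /\
            forall z, W z <-> U (proj1_sig z)) /\ U y).
  split.
  - apply open_union. intros U [H _]; exact H.
  - intro z; split.
    + intros [W [FW Wz]]. destruct (HF W FW) as [U [HU EU]].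
      exists U; split; [split; [auto | exists W; auto] | apply EU; auto].
    + intros [U [[HU [W [FW EW]]] Uz]]. exists W; split; [auto | apply EW; auto].
Qed.

Definition subspace : topology {y | A y} :=
  @Topology _ sub_open sub_open_full sub_open_inter sub_open_union.
End Subspace.

Definition LCS_complete {X : Type} (TX : topology X) : Prop :=
  exists (Y : Type) (TY : topology Y) (A : Y -> Prop),
    locally_compact TY /\ sober TY /\ G_delta TY A /\
    homeomorphic TX (subspace TY A).

(** * Extended reals, used for values in [0, oo] *)
Inductive ereal : Type := EFin (r : R) | EInf.

Definition ele (a b : ereal) : Prop :=
  match a, b with
  | EFin x, EFin y => x <= y
  | _, EInf => True
  | EInf, EFin _ => False
  end.

Definition eadd (a b : ereal) : ereal :=
  match a, b with
  | EFin x, EFin y => EFin (x + y)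
  | _, _ => EInf
  end.

Definition is_elub (S : ereal -> Prop) (s : ereal) : Prop :=
  (forall a, S a -> ele a s) /\ (forall b, (forall a, S a -> ele a b) -> ele s b).

Fixpoint epsum (f : nat -> ereal) (n : nat) : ereal :=
  match n with
  | O => EFin 0
  | S m => eadd (epsum f m) (f m)
  end.

Definition is_esum (f : nat -> ereal) (s : ereal) : Prop :=
  is_elub (fun a => exists n, a = epsum f n) s.

Section Valuations.
Context {X : Type} (T : topology X).

Definition empty_set : X -> Prop := fun _ => False.

Definition directed_open_family (D : (X -> Prop) -> Prop) : Prop :=
  (forall U, D U -> open T U) /\ (exists U, D U) /\
  (forall U V, D U -> D V -> exists W, D W /\
     (forall x, U x -> W x) /\ (forall x, V x -> W x)).

Definition continuous_valuation (nu : (X -> Prop) -> ereal) : Prop :=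
  (forall U, open T U -> ele (EFin 0) (nu U)) /\
  nu empty_set = EFin 0 /\
  (forall U V, open T U -> open T V ->
     eadd (nu U) (nu V) =
     eadd (nu (fun x => U x \/ V x)) (nu (fun x => U x /\ V x))) /\
  (forall D, directed_open_family D ->
     is_elub (fun a => exists U, D U /\ a = nu U)
             (nu (fun x => exists U, D U /\ U x))).

Definition sigma_algebra (S : (X -> Prop) -> Prop) : Prop :=
  S empty_set /\
  (forall B, S B -> S (fun x => ~ B x)) /\
  (forall Bn : nat -> X -> Prop, (forall n, S (Bn n)) ->
     S (fun x => exists n, Bn n x)).

Definition borel (B : X -> Prop) : Prop :=
  forall S, sigma_algebra S -> (forall U, open T U -> S U) -> S B.

(** a measure on the Borel sigma-algebra (values outside Borel sets are
    irrelevant) *)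
Definition borel_measure (mu : (X -> Prop) -> ereal) : Prop :=
  (forall B, borel B -> ele (EFin 0) (mu B)) /\
  mu empty_set = EFin 0 /\
  (forall Bn : nat -> X -> Prop,
     (forall n, borel (Bn n)) ->
     (forall i j x, i <> j -> Bn i x -> Bn j x -> False) ->
     is_esum (fun n => mu (Bn n)) (mu (fun x => exists n, Bn n x))).

End Valuations.

(* Main.v *)
(* Write c(U, V) = nu U - nu (U `&` V) for the measure of the crescent U `\` V,
   when U is open and nu U is finite.  The outer measure mu generated by these
   values makes every open set Caratheodory measurable, since
   c(O, W) = c(O `&` U, W) + c(O, W `|` U) by modularity.  It remains to see
   that mu O = nu O; by Scott continuity it suffices to treat nu O < +oo, an
   open set not covered by open sets of finite measure having measure +oo on
   both sides.

   If O were covered by crescents U k `\` V k with the sum of the c(U k, V k)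
   less than nu O, move to the ambient locally compact sober space and build,
   one k at a time, crescents O_n `\` W_n whose measure exceeds that of their
   traces on the remaining U k `\` V k: at step n either U n is added to W_n or
   O_n is cut down to V n.  Strictness of the inequality and Scott continuity
   leave room to interpose a compact saturated Q_n between O_(n+1) and O_n
   intersected with the n-th open set of the G_delta.  As no Q_n is included in
   the union of the W_m, well-filteredness gives a point of all the Q_n outside
   all the W_m; it lies in O and in the G_delta, but in no U k `\` V k. *)
From HB Require Import structures.
From mathcomp Require Import all_boot all_order all_algebra.
From mathcomp Require Import lra.
From mathcomp Require Import boolp classical_sets.
From mathcomp Require Import reals ereal topology normedtype sequences measure.
From mathcomp Require Import Rstruct.
Require Import Defs.

Set Implicit Arguments.
Unset Strict Implicit.
Unset Printing Implicit Defensive.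
Import Order.TTheory GRing.Theory Num.Theory.
Local Open Scope classical_set_scope.
Local Open Scope ring_scope.

(** * Sober spaces *)

Section Topology.
Context {X : Type} (T : topology X).
Implicit Types (U V W K : set X) (F : set (set X)).

Lemma open_bigcup F : F `<=` open T -> open T (\bigcup_(U in F) U).
Proof.
move=> FT; have := open_union T F FT; congr open.
by apply/predeqP => x; split=> [[U [FU Ux]]|[U FU Ux]]; exists U.
Qed.

Lemma open_set0 : open T set0.
Proof. by have := @open_bigcup set0 (sub0set _); rewrite bigcup_set0. Qed.

Lemma open_setU U V : open T U -> open T V -> open T (U `|` V).
Proof.
move=> oU oV; have := @open_bigcup [set U; V].
by rewrite bigcup_setU !bigcup_set1; apply => _ [->|->].
Qed.

Lemma open_setI U V : open T U -> open T V -> open T (U `&` V).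
Proof. exact: open_inter. Qed.

Lemma compact_set0 : compact T set0.
Proof. by move=> F _ _; exists nil; split. Qed.

Lemma compact_setU K K' : compact T K -> compact T K' -> compact T (K `|` K').
Proof.
move=> cK cK' F oF KF.
have [l [lF lK]] := cK F oF (fun x Kx => KF x (or_introl Kx)).
have [l' [lF' lK']] := cK' F oF (fun x Kx => KF x (or_intror Kx)).
exists (List.app l l'); split=> [U Ul|x Kx].
  by case: (List.in_app_or _ _ _ Ul) => [/lF|/lF'].
by case: Kx => [/lK|/lK'] [U [Ul Ux]]; exists U; split=> //;
  apply: List.in_or_app; [left|right].
Qed.

(** A finite subcover uses finitely many members of the chain, and the largest of them suffices;
    [set0] stands for the case where none is used. *)
Lemma compact_sub_chain K W F : compact T K -> open T W -> F `<=` open T ->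
    total_on F subset -> K `<=` W `|` \bigcup_(U in F) U ->
  exists2 V, (V = set0 \/ F V) & K `<=` W `|` V.
Proof.
move=> cK oW oF Ftot KWF.
have [l [lWF lK]] : exists l : seq (set X),
    (forall U, List.In U l -> U = W \/ F U) /\
    (forall x, K x -> exists U, List.In U l /\ U x).
  apply: (cK (fun U => U = W \/ F U)) => [U [->//|/oF//]|x /KWF].
  by case=> [Wx|[U FU Ux]]; [exists W|exists U]; split=> //; [left|right].
suff [V FV lV] : exists2 V, (V = set0 \/ F V) &
    forall U, List.In U l -> U `<=` W `|` V.
  by exists V => // x /lK [U [/lV UWV /UWV]].
elim: l lWF {lK} => [_|U l IHl lWF]; first by exists set0 => //; left.
have [|V FV lV] := IHl; first by move=> U' U'l; apply: lWF; right.
have [->|FU] := lWF U (or_introl erefl).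
  by exists V => // U' [<-|/lV//]; exact: subsetUl.
have [V0|{}FV] := FV.
  exists U; first by right.
  by move=> U' [<-|/lV +]; [exact: subsetUr|rewrite V0 setU0 => /subset_trans;
    apply; exact: subsetUl].
have [UV|VU] := Ftot _ _ FU FV.
  exists V; first by right.
  by move=> U' [<-|/lV//]; apply: subset_trans UV _; exact: subsetUr.
exists U; first by right.
move=> U' [<-|/lV]; first exact: subsetUr.
by move/subset_trans; apply; exact: setUS.
Qed.

(* A maximal open set containing no [Q n] has an irreducible complement, whose
   generic point lies above a point of each [Q n]. *)
Lemma sober_well_filtered (Q : nat -> set X) W : sober T ->
    (forall n, compact T (Q n)) -> (forall n, saturated T (Q n)) ->
    (forall n, Q n.+1 `<=` Q n) -> open T W -> (forall n, ~ Q n `<=` W) ->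
  exists2 x, ~ W x & forall n, Q n x.
Proof.
move=> sobT cQ sQ dQ oW QW.
have leQ m n : (m <= n)%N -> Q n `<=` Q m.
  move=> /subnK <-; elim: (n - m)%N => // k IH.
  exact: subset_trans (dQ _) IH.
(* By compactness of the [Q n] this property passes to unions of chains, the empty chain included
   since no [Q n] lies in [W]. *)
pose P := [set V | open T V /\ forall n, ~ Q n `<=` W `|` V].
have [F FP Ftot|M [[oM QM] maxM]] := @Zorn_bigcup X P.
  split=> [|n QWF]; first by apply: open_bigcup => U /FP[].
  have [|V [->|/FP[_ /(_ n)]//]] := compact_sub_chain (cQ n) oW _ Ftot QWF.
    by move=> U /FP[].
  by rewrite setU0; exact: QW.
pose M' := W `|` M.
have oM' : open T M' by exact: open_setU.
pose C := ~` M'.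
have clC : closed T C.
  rewrite /closed; suff -> : (fun x => ~ (~` M') x) = M' by [].
  by rewrite -[RHS]setCK.
(* If [A] misses a point of [C], its complement strictly enlarges [M'], so maximality fails for it.
   Two such sets covering [C] would put a later [Q n] inside [M']; hence [C] is irreducible. *)
have nonmax A x : closed T A -> C x -> ~ A x -> exists n, Q n `<=` M' `|` ~` A.
  move=> clA Cx nAx; apply: contrapT => /forallNP noQ.
  apply: (maxM (M' `|` ~` A)).
    split; first by move=> y My; left; right.
    by move=> /(_ x) MA; apply: Cx; right; apply: MA; right.
  split=> [|n]; first exact: open_setU.
  by rewrite setUA setUA setUid; exact: noQ.
have irrC : irreducible T C.
  split=> [|A B clA clB CAB].
    by apply: contrapT => /forallNP Ce; apply: (QM 0%N) => x _;
      exact: contrapT (Ce x).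
  apply: contrapT => /not_orP[/existsNP[x /not_implyP[Cx nAx]]].
  move=> /existsNP[y /not_implyP[Cy nBy]].
  have [m mA] := nonmax _ _ clA Cx nAx; have [n nB] := nonmax _ _ clB Cy nBy.
  apply: (QM (maxn m n)) => z Qz; apply: contrapT => M'z.
  have [//|nAz] := mA z (leQ _ _ (leq_maxl m n) z Qz).
  have [//|nBz] := nB z (leQ _ _ (leq_maxr m n) z Qz).
  by have [] := CAB z M'z.
have [x [Cx _]] := sobT C clC irrC; exists x => [Wx|n].
  have : C x by apply/Cx => U _ Ux; exists x.
  by apply; left.
have /existsNP[y /not_implyP[Qy My]] := QM n.
apply: (sQ n y) => // U oU Uy.
by have /Cx/(_ U oU Uy)[z [Uz <-]] : C y by [].
Qed.

End Topology.

(** * Valuations on crescents *)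

(** Scott continuity is split into monotonicity and the statement that an upper bound on a directed
    family bounds the value at its union. *)
Record valuation (R : realType) (X : Type) (T : topology X)
    (nu : set X -> \bar R) : Prop := Valuation {
  valuation_ge0 : forall U, open T U -> (0 <= nu U)%E;
  valuation_set0 : nu set0 = 0%E;
  valuation_modular : forall U V, open T U -> open T V ->
    (nu U + nu V = nu (U `|` V) + nu (U `&` V))%E;
  valuation_le : forall U V, open T U -> open T V -> U `<=` V ->
    (nu U <= nu V)%E;
  valuation_directed : forall D y, directed_open_family T D ->
    (forall U, D U -> (nu U <= y)%E) -> (nu (\bigcup_(U in D) U) <= y)%E }.

Section Crescents.
Context {R : realType} {X : Type} {T : topology X} {nu : set X -> \bar R}.
Hypothesis val_nu : valuation T nu.
Implicit Types (O U V W A B : set X).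

Definition fin_open U := open T U /\ (nu U < +oo)%E.

(** [fine] sends [+oo] to 0, so the value is meaningful only when [nu U] is finite. *)
Definition crescent_val U V : R := fine (nu U) - fine (nu (U `&` V)).

Lemma fin_open_sub U V : fin_open V -> open T U -> U `<=` V -> fin_open U.
Proof.
move=> [oV Voo] oU UV; split=> //.
exact: le_lt_trans (valuation_le val_nu oU oV UV) Voo.
Qed.

Lemma fin_openIl U V : fin_open U -> open T V -> fin_open (U `&` V).
Proof.
move=> fU oV; have [oU _] := fU.
by apply: (fin_open_sub fU) => //; exact: open_setI.
Qed.

Lemma fin_open0 : fin_open set0.
Proof. by split; [exact: open_set0|rewrite (valuation_set0 val_nu) ltry]. Qed.

Lemma fin_open_fineK U : fin_open U -> (fine (nu U))%:E = nu U.
Proof.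
by case=> oU Uoo; rewrite fineK// ge0_fin_numE// (valuation_ge0 val_nu).
Qed.

Lemma fin_openU U V : fin_open U -> fin_open V -> fin_open (U `|` V).
Proof.
move=> fU fV; have [[oU Uoo] [oV Voo]] := (fU, fV).
split; first exact: open_setU.
have := valuation_modular val_nu oU oV.
rewrite -(fin_open_fineK fU) -(fin_open_fineK fV) -EFinD => UV.
apply: (@le_lt_trans _ _ (fine (nu U) + fine (nu V))%:E); last exact: ltry.
by rewrite UV leeDl// (valuation_ge0 val_nu)//; exact: open_setI.
Qed.

Lemma fine_le U V : fin_open V -> open T U -> U `<=` V ->
  fine (nu U) <= fine (nu V).
Proof.
move=> fV oU UV; have fU := fin_open_sub fV oU UV.
rewrite -lee_fin !fin_open_fineK//.
by apply: (valuation_le val_nu) => //; case: fV.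
Qed.

Lemma fine_modular U V : fin_open U -> fin_open V ->
  fine (nu U) + fine (nu V) = fine (nu (U `|` V)) + fine (nu (U `&` V)).
Proof.
move=> fU fV; apply: EFin_inj; rewrite !EFinD !fin_open_fineK//.
- by apply: (valuation_modular val_nu); [case: fU|case: fV].
- by apply: fin_openIl => //; case: fV.
- exact: fin_openU.
Qed.

(** This is modularity for [O]&[W] and [O]&[U]. *)
Lemma crescent_split O W U : fin_open O -> open T W -> open T U ->
  crescent_val O W = crescent_val (O `&` U) W + crescent_val O (W `|` U).
Proof.
move=> fO oW oU; rewrite /crescent_val.
have := fine_modular (fin_openIl fO oW) (fin_openIl fO oU).
rewrite -setIUr -setIIr (setIC W) setIA; lra.
Qed.

Lemma crescent_ge0 U V : fin_open U -> open T V -> 0 <= crescent_val U V.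
Proof.
move=> fU oV; rewrite subr_ge0; apply: fine_le => //.
by apply: open_setI => //; case: fU.
Qed.

Lemma crescent_le_fst U U' V : fin_open U' -> open T U -> open T V ->
  U `<=` U' -> crescent_val U V <= crescent_val U' V.
Proof.
move=> fU' oU oV UU'; rewrite (crescent_split fU' oV oU) (setIidr UU') lerDl.
by apply: crescent_ge0 => //; exact: open_setU.
Qed.

Lemma crescent_leU U V W : fin_open U -> open T V -> open T W ->
  crescent_val U (V `|` W) <= crescent_val U V.
Proof.
by move=> fU oV oW; rewrite (crescent_split fU oV oW) lerDr crescent_ge0//;
  exact: fin_openIl.
Qed.

Lemma crescent_eq0 U V : U `<=` V -> crescent_val U V = 0.
Proof. by move=> /setIidl UV; rewrite /crescent_val UV subrr. Qed.

(** In particular the value depends only on the difference set. Cutting along [U'] and then along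
    [V'] discards only pieces contained in [V], which have value 0. *)
Lemma crescent_le U V U' V' : fin_open U -> open T V -> fin_open U' ->
  open T V' -> U `\` V `<=` U' `\` V' -> crescent_val U V <= crescent_val U' V'.
Proof.
move=> fU oV fU' oV' UVUV'; have [[oU _] [oU' _]] := (fU, fU').
rewrite (crescent_split fU oV oU') [X in _ + X]crescent_eq0 ?addr0; last first.
  move=> x Ux; have [Vx|nVx] := pselect (V x); first by left.
  by right; have [] := UVUV' x (conj Ux nVx).
have fUU' : fin_open (U `&` U') by exact: fin_openIl.
rewrite (crescent_split fUU' oV oV') [X in X + _]crescent_eq0 ?add0r;
    last first.
  move=> x [[Ux U'x] V'x]; apply: contrapT => nVx.
  by have [] := UVUV' x (conj Ux nVx).
apply: (@le_trans _ _ (crescent_val U' (V `|` V'))).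
  by apply: crescent_le_fst => //; [exact: open_setI|exact: open_setU].
by rewrite setUC; exact: crescent_leU.
Qed.

End Crescents.
Arguments fin_open {R X} T nu U.
Arguments crescent_val {R X} nu U V.

(** * Crescents that exceed their traces, and points avoiding a sequence of crescents *)

Section Excess.
Context {R : realType} {X : Type} {T : topology X} {nu : set X -> \bar R}.
Hypothesis val_nu : valuation T nu.
Variables U V : nat -> set X.
Hypotheses (oU : forall n, open T (U n)) (oV : forall n, open T (V n)).
Hypothesis VU : forall n, V n `<=` U n.
Implicit Types (O W : set X).

Local Notation c := (crescent_val nu).
Let trace O W k := c (O `&` U k) (W `|` V k).

(* The crescent [O `\` W] has measure more than the sum of the measures of its
   traces on the crescents [U k `\` V k], [n <= k]. *)
Definition excess O W n :=
  exists2 r : R, r < c O W & forall N, \sum_(k < N) trace O W (n + k)%N <= r.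

Lemma excess_not_sub O W n : excess O W n -> ~ O `<=` W.
Proof.
move=> [r + /(_ 0%N)]; rewrite big_ord0 => rc r0 /(crescent_eq0 (nu := nu)) c0.
by move: rc; rewrite c0 ltNge r0.
Qed.

(** The crescent decomposes into the two candidates and its trace on [U n]\[V n], and the later
    traces of the candidates add up to at most those of the whole. So the slack must remain in one
    of the two. *)
Lemma excess_split O W n : fin_open T nu O -> open T W -> excess O W n ->
  excess O (W `|` U n) n.+1 \/ excess (O `&` V n) W n.+1.
Proof.
move=> fO oW [r rc tr].
have fOI A : open T A -> fin_open T nu (O `&` A) by exact: fin_openIl.
have fOIUV k : fin_open T nu (O `&` V n `&` U k) by do 2?apply: fin_openIl.
have ocW k : open T (W `|` V k) by exact: open_setU.
have cE : c O W = c O (W `|` U n) + c (O `&` V n) W + trace O W n.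
  rewrite (crescent_split val_nu fO oW (oU n)).
  rewrite (crescent_split val_nu (fOI _ (oU n)) oW (oV n)).
  by rewrite -setIA (setIidr (@VU n)) /trace; lra.
have traceE k : trace O (W `|` U n) k + trace (O `&` V n) W k <= trace O W k.
  rewrite /trace (crescent_split val_nu (fOI _ (oU k)) (ocW k) (oU n)).
  rewrite addrC setUAC lerD2r; apply: (crescent_le_fst val_nu) => //.
  - exact: (fin_openIl val_nu (fOI _ (oU k))).
  - by case: (fOIUV k).
  by move=> x [[Ox Vx] Ux]; split=> //; exact: VU.
have sumE N : \sum_(k < N) trace O (W `|` U n) (n.+1 + k)%N +
    \sum_(k < N) trace (O `&` V n) W (n.+1 + k)%N + trace O W n <= r.
  apply: le_trans (tr N.+1); rewrite big_ord_recl addn0 addrC lerD2l.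
  rewrite -big_split/=; apply: ler_sum => i _.
  by rewrite /bump/= add1n -addSnnS.
have mono A B M N : fin_open T nu A -> open T B -> (M <= N)%N ->
    \sum_(k < M) trace A B (n.+1 + k)%N <= \sum_(k < N) trace A B (n.+1 + k)%N.
  move=> fA oB MN.
  rewrite (big_ord_widen N (fun k => trace A B (n.+1 + k)%N) MN).
  rewrite [leRHS](bigID (fun k : 'I_N => k < M)%N)/= lerDl sumr_ge0// => k _.
  by apply: (crescent_ge0 val_nu); [exact: fin_openIl|exact: open_setU].
(* A candidate without excess has a partial sum of traces within [d / 2] of its measure. If both
   lacked excess, summing up to the larger length would contradict [sumE]. *)
pose d := c O W - r; have d0 : 0 < d by rewrite subr_gt0.
have noexcess A B : ~ excess A B n.+1 ->
    exists N, c A B - d / 2 < \sum_(k < N) trace A B (n.+1 + k)%N.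
  move=> nAB; apply: contrapT => /forallNP ltN; apply: nAB.
  exists (c A B - d / 2); first lra.
  by move=> N; rewrite leNgt; apply/negP; exact: ltN.
apply: contrapT => /not_orP[/noexcess[M ltM] /noexcess[N ltN]].
have oWU : open T (W `|` U n) by exact: open_setU.
have := mono _ _ _ _ fO oWU (leq_maxl M N).
have := mono _ _ _ _ (fOI _ (oV n)) oW (leq_maxr M N).
by have := sumE (maxn M N); rewrite /d in ltM ltN; lra.
Qed.

(** A witness that [O'] is way below [O]. *)
Definition sandwich O' Q O :=
  [/\ open T O', compact T Q, saturated T Q, O' `<=` Q & Q `<=` O].

(** By local compactness the open sets sandwiched below [O] form a directed family with union [O],
    so Scott continuity applies. *)
Lemma inner_regular O (r : R) : locally_compact T -> open T O ->
  (r%:E < nu O)%E -> exists O' Q, sandwich O' Q O /\ (r%:E < nu O')%E.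
Proof.
move=> lcT oO rO; apply: contrapT => noO'.
pose D O' := exists Q, sandwich O' Q O.
suff : (nu O <= r%:E)%E by rewrite leNgt rO.
have -> : O = \bigcup_(O' in D) O'.
  apply/seteqP; split=> [x Ox|x [O' [Q [_ _ _ O'Q QO]] /O'Q/QO]//].
  have [K [O' [oO' [O'x [O'K [KO [cK sK]]]]]]] := lcT x O oO Ox.
  by exists O' => //; exists K.
apply: (valuation_directed val_nu); last first.
  move=> O' [Q O'QO]; rewrite leNgt; apply/negP => rO'.
  by apply: noO'; exists O', Q.
split; first by move=> O' [Q []].
split.
  exists set0; exists set0; split=> //; first exact: open_set0.
  exact: compact_set0.
move=> A B [Q [oA cQ sQ AQ QO]] [Q' [oB cQ' sQ' BQ' Q'O]].
exists (A `|` B); split; last by split=> x; [left|right].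
exists (Q `|` Q'); split.
- exact: open_setU.
- exact: compact_setU.
- by move=> x y [Qx|Q'x] xy; [left; exact: sQ Qx xy|right; exact: sQ' Q'x xy].
- exact: setUSS.
- by rewrite subUset.
Qed.

(** Shrinking [O] only decreases the traces, so the same bound [r] serves as long as the measure of
    the smaller crescent stays above it. *)
Lemma excess_shrink O G W n : locally_compact T -> fin_open T nu O ->
    open T G -> nu (O `&` G) = nu O -> open T W -> excess O W n ->
  exists O' Q, sandwich O' Q (O `&` G) /\ excess O' W n.
Proof.
move=> lcT fO oG OG oW [r rc tr]; have [oO _] := fO.
have oOG : open T (O `&` G) by exact: open_setI.
(* Any [O'] inside [O] above this threshold satisfies [r < c O' W], because the part of [O'] in [W]
   weighs at most that of [O]. *)
have : ((fine (nu (O `&` W)) + r)%:E < nu (O `&` G))%E.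
  rewrite OG -(fin_open_fineK val_nu fO) lte_fin.
  by move: rc; rewrite /crescent_val; lra.
move=> /(inner_regular lcT oOG)[O' [Q [[oO' cQ sQ O'Q QO] rO']]].
exists O', Q; split=> //.
have O'O : O' `<=` O by move=> x /O'Q/QO[].
have fO' : fin_open T nu O' by exact: fin_open_sub O'O.
exists r.
  move: rO'; rewrite -(fin_open_fineK val_nu fO') lte_fin.
  have := fine_le val_nu (fin_openIl val_nu fO oW) (open_setI oO' oW)
     (setSI O'O).
  by rewrite /crescent_val; lra.
move=> N; apply: le_trans (tr N); apply: ler_sum => k _.
apply: (crescent_le_fst val_nu); first exact: fin_openIl.
- exact: open_setI.
- exact: open_setU.
- exact: setSI.
Qed.

(** Meant for the ambient space with the image valuation, for which every [G n] carries full
    measure. *)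
Lemma excess_point (G : nat -> set X) O : locally_compact T -> sober T ->
    (forall n, open T (G n)) ->
    (forall n A, open T A -> nu (A `&` G n) = nu A) ->
    fin_open T nu O -> excess O set0 0 ->
  exists x, [/\ O x, forall n, G n x & forall n, ~ (U n `\` V n) x].
Proof.
move=> lcT sobT oG nuG fO exO.
(* A state holds the open set, the set [W] to avoid, and the compact set interposed at the previous
   step; hence the shift in [Q] below and the dummy third component of the initial state. *)
pose P n (s : set X * set X * set X) :=
  [/\ fin_open T nu s.1.1, open T s.1.2 & excess s.1.1 s.1.2 n].
pose step n (s s' : set X * set X * set X) :=
  [/\ P n.+1 s', sandwich s'.1.1 s'.2 (s.1.1 `&` G n), s.1.2 `<=` s'.1.2 &
      U n `<=` s'.1.2 \/ s'.2 `<=` V n].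
have /choice[f fP] : forall p : nat * (set X * set X * set X),
    exists q, P p.1 p.2 -> step p.1 p.2 q.
  move=> [n [[A W] Q]]; have [|nP] := pselect (P n (A, W, Q));
    last by exists (A, W, Q).
  move=> [/= fA oW exA].
  have [exA'|exA'] := excess_split fA oW exA.
    have oWU : open T (W `|` U n) by exact: open_setU.
    have [A' [Q' [[oA' cQ' sQ' A'Q' Q'A] ex']]] :=
      excess_shrink lcT fA (oG n) (nuG n _ fA.1) oWU exA'.
    exists (A', W `|` U n, Q') => _; split=> //=; last by left; exact: subsetUr.
      split=> //=; apply: (fin_open_sub val_nu fA) => //.
      by move=> x /A'Q'/Q'A[].
  have fAV : fin_open T nu (A `&` V n) by exact: fin_openIl.
  have [A' [Q' [[oA' cQ' sQ' A'Q' Q'A] ex']]] :=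
    excess_shrink lcT fAV (oG n) (nuG n _ fAV.1) oW exA'.
  exists (A', W, Q') => _; split=> //=; last by right=> x /Q'A[[]].
    split=> //=; apply: (fin_open_sub val_nu fAV) => //.
    by move=> x /A'Q'/Q'A[].
  by split=> // x /Q'A[[]].
pose s := fix s n := if n is m.+1 then f (m, s m) else (O, set0, set0).
have Ps n : P n (s n).
  elim: n => [|n IHn]; first by split=> //; exact: open_set0.
  by have [] := fP (n, s n) IHn.
have steps n : step n (s n) (s n.+1) := fP (n, s n) (Ps n).
pose Q n := (s n.+1).2; pose W n := (s n).1.2.
have dQ n : Q n.+1 `<=` Q n.
  have [_ [_ _ _ _ QO] _ _] := steps n.+1.
  have [_ [_ _ _ OQ _] _ _] := steps n.
  by move=> x /QO[/OQ].
have leQ m n : (m <= n)%N -> Q n `<=` Q m.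
  move=> /subnK <-; elim: (n - m)%N => // k IH.
  exact: subset_trans (dQ _) IH.
have leW m n : (m <= n)%N -> W m `<=` W n.
  move=> /subnK <-; elim: (n - m)%N => // k IH.
  by have [_ _ Wk _] := steps (k + m)%N; exact: subset_trans IH Wk.
(* Otherwise, with N the successor of the maximum of [m] and [n], the open set of stage N would lie
   in [Q m], hence in [W n] and in W N, against its excess. *)
have QW m n : ~ Q m `<=` W n.
  move=> QW; have [_ _ /excess_not_sub] := Ps (maxn m n).+1; apply.
  have [_ [_ _ _ OQ _] _ _] := steps (maxn m n).
  apply: subset_trans OQ _; apply: subset_trans (leQ _ _ (leq_maxl m n)) _.
  by apply: subset_trans QW _; apply: leW; exact/ltnW/leq_maxr.
have oW : range W `<=` open T by move=> _ [n _ <-]; have [] := Ps n.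
have [x nWx Qx] : exists2 x, ~ (\bigcup_(A in range W) A) x & forall n, Q n x.
  apply: (sober_well_filtered sobT) => //.
  - by move=> n; have [_ [_ cQ _ _ _] _ _] := steps n.
  - by move=> n; have [_ [_ _ sQ _ _] _ _] := steps n.
  - exact: open_bigcup.
  (* The [W m] form a chain, so compactness reduces inclusion in their union to inclusion in one of
     them. *)
  move=> n QnW; have [_ [_ cQ _ _ _] _ _] := steps n.
  have [||A AW] := compact_sub_chain cQ (open_set0 T) oW.
  - move=> _ _ [i _ <-] [j _ <-].
    by have /orP[/leW|/leW] := leq_total i j; [left|right].
  - by rewrite set0U.
  rewrite set0U; case: AW => [->|[m _ <-]]; last exact: QW.
  by move=> Q0; apply: (@QW n 0%N) => x /Q0.
exists x; split.
- by have [_ [_ _ _ _ QO] _ _] := steps 0%N; have [] := QO _ (Qx 0%N).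
- by move=> n; have [_ [_ _ _ _ QO] _ _] := steps n; have [] := QO _ (Qx n).
- move=> n [Ux Vx]; have [_ _ _ [UW|QV]] := steps n; last exact/Vx/QV/Qx.
  by apply: nWx; exists (W n.+1); [exists n.+1|exact: UW].
Qed.

End Excess.

(** * The outer measure *)

(* [mu_ext] wants a pointed type with a semiring of sets: take all of them. *)
Definition discrete (X : Type) (x0 : X) : Type := X.

Section Discrete.
Context {X : Type} (x0 : X).
HB.instance Definition _ := gen_eqMixin (discrete x0).
HB.instance Definition _ := gen_choiceMixin (discrete x0).
HB.instance Definition _ := isPointed.Build (discrete x0) x0.
HB.instance Definition _ := @isMeasurable.Build default_measure_display
  (discrete x0) (@discrete_measurable (discrete x0))
  (@discrete_measurable0 _) (@discrete_measurableC _) (@discrete_measurableU _).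
End Discrete.

Section CrescentOuterMeasure.
Context {R : realType} {X : Type} {T : topology X} {nu : set X -> \bar R}.
Hypothesis val_nu : valuation T nu.
Implicit Types (A B C G O : set X) (U V : nat -> set X).
Local Open Scope ereal_scope.

Definition fin_crescent (p : set X * set X) := fin_open T nu p.1 /\ open T p.2.

(* [+oo] on the sets that are not crescents of finite measure. *)
Definition crescent_content C : \bar R := ereal_inf
  [set (crescent_val nu p.1 p.2)%:E | p in
    [set p | fin_crescent p /\ C = p.1 `\` p.2]].

(** All representations of a set as a finite crescent have the same value, by [crescent_le]. *)
Lemma crescent_contentE W1 W2 : fin_open T nu W1 -> open T W2 ->
  crescent_content (W1 `\` W2) = (crescent_val nu W1 W2)%:E.
Proof.
move=> fW1 oW2; apply/eqP; rewrite eq_le; apply/andP; split.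
  by apply: ereal_inf_lbound; exists (W1, W2).
apply: le_ereal_inf_tmp => _ [[U V] [[/= fU oV] WUV] <-].
by rewrite lee_fin; apply: (crescent_le val_nu) => //; rewrite WUV.
Qed.

Lemma crescent_contentP C : crescent_content C < +oo ->
  exists2 p, fin_crescent p & C = p.1 `\` p.2.
Proof.
move=> Coo; apply: contrapT => noC; move: Coo; rewrite /crescent_content.
rewrite (_ : [set p | _] = set0) ?image_set0 ?ereal_inf0 ?ltxx//.
by apply/seteqP; split=> // p [fp Cp]; apply: noC; exists p.
Qed.

Lemma crescent_content_ge0 C : 0 <= crescent_content C.
Proof.
apply: le_ereal_inf_tmp => _ [[U V] [[/= fU oV] _] <-].
by rewrite lee_fin; exact: (crescent_ge0 val_nu).
Qed.

Lemma crescent_content0 : crescent_content set0 = 0.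
Proof.
rewrite -(setD0 set0) crescent_contentE; last exact: open_set0.
  by rewrite crescent_eq0.
exact: fin_open0.
Qed.

Lemma crescent_content_splitting C G : open T G ->
  crescent_content (C `&` G) + crescent_content (C `&` ~` G) <=
  crescent_content C.
Proof.
move=> oG; have [/crescent_contentP[[U V] /= [fU oV] ->]|] :=
  ltP (crescent_content C) +oo; last by rewrite leye_eq => /eqP ->; exact: leey.
rewrite (_ : (U `\` V) `&` G = (U `&` G) `\` V); last first.
  by rewrite !setDE -!setIA (setIC G).
rewrite (_ : (U `\` V) `&` ~` G = U `\` (V `|` G)); last first.
  by rewrite !setDE setCU setIA.
rewrite !crescent_contentE//; last 2 first.
- exact: open_setU.
- exact: fin_openIl.
by rewrite -EFinD (crescent_split val_nu fU oV oG).
Qed.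

Section Pointed.
Variable x0 : X.

Definition valuation_outer : set X -> \bar R :=
  @mu_ext _ (discrete x0) R crescent_content.

HB.instance Definition _ := isOuterMeasure.Build R X valuation_outer
  (@mu_ext0 _ (discrete x0) R _ crescent_content0 crescent_content_ge0)
  (@mu_ext_ge0 _ (discrete x0) R _ crescent_content_ge0)
  (@le_mu_ext _ (discrete x0) R crescent_content)
  (@mu_ext_sigma_subadditive _ (discrete x0) R _ crescent_content_ge0).

Lemma valuation_outer_le A (C : nat -> set X) : A `<=` \bigcup_k C k ->
  valuation_outer A <= \sum_(k <oo) crescent_content (C k).
Proof. by move=> AC; apply: ereal_inf_lbound; exists C. Qed.

Lemma open_caratheodory G : open T G -> valuation_outer.-caratheodory G.
Proof.
move=> oG; apply: le_caratheodory_measurable => A.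
apply: le_ereal_inf_tmp => _ [C [_ AC] <-].
apply: (@le_trans _ _ (\sum_(k <oo) crescent_content (C k `&` G) +
    \sum_(k <oo) crescent_content (C k `&` ~` G))).
  by apply: leeD; apply: valuation_outer_le; rewrite -setI_bigcupl;
    exact: setSI.
rewrite -nneseriesD; [|by move=> *; exact: crescent_content_ge0..].
apply: lee_nneseries => [k _ _|k _].
  by apply: adde_ge0; exact: crescent_content_ge0.
exact: crescent_content_splitting.
Qed.

(** LCS-completeness enters only through this inequality, established in
    [LCS_crescent_subadditive]. *)
Hypothesis sigma_subadd : forall O U V, fin_open T nu O ->
  (forall k, fin_open T nu (U k)) -> (forall k, open T (V k)) ->
  O `<=` \bigcup_k (U k `\` V k) ->
  nu O <= \sum_(k <oo) (crescent_val nu (U k) (V k))%:E.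

Lemma valuation_outer_fin O : fin_open T nu O -> valuation_outer O = nu O.
Proof.
move=> fO; apply/eqP; rewrite eq_le; apply/andP; split.
  pose C k := if k is 0%N then O else set0.
  apply: le_trans (@valuation_outer_le O C _) _.
    by move=> x Ox; exists 0%N.
  rewrite nneseries_recl//; last by move=> *; exact: crescent_content_ge0.
  rewrite eseries_cond/= eseries0 ?adde0; last first.
    by move=> [|k]//= _ _; rewrite crescent_content0.
  rewrite -{1}(setD0 O) crescent_contentE//; last exact: open_set0.
  rewrite /crescent_val setI0 (valuation_set0 val_nu) subr0.
  by rewrite (fin_open_fineK val_nu).
apply: le_ereal_inf_tmp => _ [C [_ OC] <-].
(* A cover with a member of infinite content has infinite sum; otherwise all members are finite
   crescents and [sigma_subadd] applies. *)
have [[k Ck]|noCk] := pselect (exists k, crescent_content (C k) = +oo).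
  rewrite (eseries_pinfty _ _ Ck) ?leey// => n _.
  by rewrite -ltNye (lt_le_trans _ (crescent_content_ge0 _)).
have /choice[p pC] : forall k, exists p,
    fin_crescent p /\ C k = p.1 `\` p.2.
  move=> k; have [|p fp Ck] := @crescent_contentP (C k); last by exists p.
  by rewrite ltey; apply/eqP => Ck; apply: noCk; exists k.
apply: le_trans (@sigma_subadd O (fst \o p) (snd \o p) fO _ _ _) _.
- by move=> k; case: (pC k) => -[].
- by move=> k; case: (pC k) => -[].
- by move=> x /OC[k _ Ckx]; exists k => //; move: Ckx; case: (pC k) => _ ->.
apply: lee_nneseries => k _ *; first by
  rewrite lee_fin; apply: (crescent_ge0 val_nu); case: (pC k) => -[].
by case: (pC k) => -[fU oV] ->; rewrite crescent_contentE.
Qed.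

Lemma valuation_outer_open O : open T O -> valuation_outer O = nu O.
Proof.
move=> oO; have [Ofin|/existsNP[x /not_implyP[Ox nfin]]] :=
  pselect (forall x, O x -> exists2 U, fin_open T nu U & U x); last first.
  have -> : nu O = +oo.
    apply/eqP; rewrite -leye_eq leNgt; apply/negP => Ooo.
    by apply: nfin; exists O.
  apply/eqP; rewrite -leye_eq; apply: le_ereal_inf_tmp => _ [C [_ OC] <-].
  (* The member of the cover containing [x] cannot be a finite crescent, as [x] has no open
     neighborhood of finite measure; its content is therefore [+oo]. *)
  rewrite leye_eq; apply/eqP; have [k _ Ckx] := OC x Ox.
  apply: (@eseries_pinfty _ _ _ k) => // [n _|].
    by rewrite -ltNye (lt_le_trans _ (crescent_content_ge0 _)).
  apply/eqP; rewrite -leye_eq leNgt; apply/negP.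
  move=> /crescent_contentP[[U V] /= [fU _] CUV]; apply: nfin; exists U => //.
  by move: Ckx; rewrite CUV => -[].
(* Modularity makes these sets of finite measure directed; here they exhaust [O]. *)
pose D := [set U | fin_open T nu U /\ U `<=` O].
have OD : O = \bigcup_(U in D) U.
  apply/seteqP; split=> [x Ox|x [U [_ UO] /UO]//].
  have [U fU Ux] := Ofin x Ox; exists (U `&` O) => //; split=> //.
  exact: fin_openIl.
apply/eqP; rewrite eq_le; apply/andP; split.
  have [Ooo|] := ltP (nu O) +oo; last first.
    by rewrite leye_eq => /eqP ->; exact: leey.
  by rewrite valuation_outer_fin.
rewrite [X in nu X]OD; apply: (valuation_directed val_nu).
  split; first by move=> U [[]].
  split; first by exists set0; split=> //; exact: fin_open0.
  move=> U V [fU UO] [fV VO]; exists (U `|` V); split.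
    by split; [exact: fin_openU|rewrite subUset].
  by split=> x; [left|right].
move=> U [fU UO]; rewrite -valuation_outer_fin//; exact: le_outer_measure.
Qed.

Lemma valuation_extends_outer : exists mu : {outer_measure set X -> \bar R},
  open T `<=` mu.-caratheodory /\ (forall O, open T O -> mu O = nu O).
Proof.
exists valuation_outer; split; first exact: open_caratheodory.
exact: valuation_outer_open.
Qed.

End Pointed.
End CrescentOuterMeasure.

(** * LCS-complete spaces *)

Lemma valuation_pushforward (R : realType) (X Y : Type) (TX : topology X)
    (TY : topology Y) (h : X -> Y) (nu : set X -> \bar R) :
  continuous TX TY h -> valuation TX nu ->
  valuation TY (fun V => nu (h @^-1` V)).
Proof.
move=> ch [nu_ge0 nu0 nuM nu_le nuD]; split=> //.
- by move=> V oV; exact/nu_ge0/ch.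
- by move=> U V oU oV; apply: nuM; exact: ch.
- by move=> U V oU oV UV; apply: nu_le; [exact: ch..|move=> x /UV].
move=> D y [oD [[V0 DV0] dD]] Dy; rewrite preimage_bigcup.
rewrite (_ : \bigcup_(V in D) _ =
    \bigcup_(U in [set h @^-1` V | V in D]) U); last by rewrite bigcup_image.
apply: nuD => [|_ [V DV <-]]; last exact: Dy.
split; first by move=> _ [V DV <-]; exact/ch/oD.
split; first by exists (h @^-1` V0), V0.
move=> _ _ [V DV <-] [V' DV' <-]; have [W [DW [VW V'W]]] := dD _ _ DV DV'.
by exists (h @^-1` W); split; [exists W|split=> x; [exact: VW|exact: V'W]].
Qed.

Lemma LCS_complete_embedding (X : Type) (TX : topology X) : LCS_complete TX ->
  exists (Y : Type) (TY : topology Y) (h : X -> Y), [/\ locally_compact TY,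
    sober TY, G_delta TY (range h), continuous TX TY h &
    forall U, open TX U -> exists2 V, open TY V & U = h @^-1` V].
Proof.
move=> [Y [TY [A [lcY [sobY [GA [f [g [fK [gK [cf cg]]]]]]]]]]].
exists Y, TY, (fun x => proj1_sig (f x)); split=> //.
- suff -> : range (fun x => proj1_sig (f x)) = A by [].
  apply/seteqP; split=> [_ [x _ <-]|y Ay]; first exact: proj2_sig.
  by exists (g (exist _ y Ay)) => //; rewrite gK.
- by move=> V oV; apply: (cf (fun z => V (proj1_sig z))); exists V.
- move=> U /cg[V [oV UV]]; exists V => //.
  by apply/predeqP => x; rewrite -{1}(fK x); exact: UV.
Qed.

Lemma LCS_crescent_subadditive (R : realType) (X : Type) (T : topology X)
    (nu : set X -> \bar R) (O : set X) (U V : nat -> set X) :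
  LCS_complete T -> valuation T nu -> fin_open T nu O ->
  (forall k, fin_open T nu (U k)) -> (forall k, open T (V k)) ->
  O `<=` \bigcup_k (U k `\` V k) ->
  (nu O <= \sum_(k <oo) (crescent_val nu (U k) (V k))%:E)%E.
Proof.
move=> /LCS_complete_embedding[Y [TY [h [lcY sobY [G [oG GE]] ch hopen]]]].
move=> val_nu fO fU oV OUV; rewrite leNgt; apply/negP => sumO.
have val_nuY := valuation_pushforward ch val_nu.
have [O' oO' OE] := hopen O fO.1.
have /choice[U' U'E] : forall k, exists W, open TY W /\ U k = h @^-1` W.
  by move=> k; have [W] := hopen (U k) (fU k).1; exists W.
have /choice[V' V'E] : forall k, exists W, open TY W /\ V k = h @^-1` W.
  by move=> k; have [W] := hopen (V k) (oV k); exists W.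
(* The excess argument wants the removed set inside the other one; intersecting leaves the
   difference unchanged. *)
pose V'' k := U' k `&` V' k.
have oU' k : open TY (U' k) by case: (U'E k).
have oV'' k : open TY (V'' k) by apply: open_setI => //; case: (V'E k).
have c_ge0 k : (0 <= (crescent_val nu (U k) (V k))%:E)%E.
  by rewrite lee_fin; exact: (crescent_ge0 val_nu).
have exO : excess (nu := fun W => nu (h @^-1` W)) U' V'' O' set0 0.
  have sE : (\sum_(k <oo) (crescent_val nu (U k) (V k))%:E)%E \is a fin_num.
    rewrite ge0_fin_numE; last exact: nneseries_ge0.
    exact: lt_trans sumO fO.2.
  (* The bound is the whole sum, finite because it is below [nu O]; each trace is at most the
     crescent it comes from. *)
  exists (fine (\sum_(k <oo) (crescent_val nu (U k) (V k))%:E)%E) => [|N].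
    rewrite /crescent_val setI0 preimage_set0 (valuation_set0 val_nu) subr0.
    by rewrite -OE -lte_fin fineK// (fin_open_fineK val_nu).
  rewrite -lee_fin fineK// -sumEFin.
  apply: le_trans (nneseries_lim_ge N _) => //.
  rewrite big_mkord; apply: lee_sum => k _; rewrite lee_fin add0n set0U.
  have -> : crescent_val (fun W => nu (h @^-1` W)) (O' `&` U' k) (V'' k) =
      crescent_val nu (O `&` U k) (U k `&` V k).
    by rewrite OE (U'E k).2 (V'E k).2.
  have oUV : open T (U k `&` V k) by apply: open_setI => //; case: (fU k).
  apply: (le_trans (crescent_le_fst val_nu (fU k) _ oUV _)) => //.
    by apply: open_setI; [case: fO|case: (fU k)].
  by rewrite /crescent_val setIA setIid.
have [||y [Oy Gy UVy]] := excess_point val_nuY oU' oV''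
    (fun k => @subIsetl _ _ _) lcY sobY oG _ _ exO.
(* The range of [h] lies in every [G n], so both sets have the same preimage. *)
- move=> n W oW; congr nu; apply/seteqP; split=> [x []//|x Wx]; split=> //.
  by apply/(GE (h x)).1; exists x.
- by split=> //; rewrite -OE; case: fO.
have [x _ hx] := (GE y).2 Gy.
have /OUV[k _ []] : O x by rewrite OE /= hx.
rewrite (U'E k).2 (V'E k).2 /= hx => Uky Vky.
by apply: (UVy k); split=> // -[].
Qed.

(** * Translation between the two types of extended reals *)

Definition to_bar (a : Defs.ereal) : \bar Rdefinitions.R :=
  if a is Defs.EFin r then r%:E else +oo%E.

(* The value at [-oo] is irrelevant. *)
Definition of_bar (x : \bar Rdefinitions.R) : Defs.ereal :=
  if x is r%:E then Defs.EFin r else EInf.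

Lemma to_barK : cancel to_bar of_bar. Proof. by case. Qed.

Lemma of_barK x : (0 <= x)%E -> to_bar (of_bar x) = x.
Proof. by case: x. Qed.

Lemma to_bar_eadd a b : to_bar (eadd a b) = (to_bar a + to_bar b)%E.
Proof. by case: a b => [r|] [s|]. Qed.

Lemma ele_to_bar a b : ele a b <-> (to_bar a <= to_bar b)%E.
Proof.
case: a b => [r|] [s|] /=; [|by rewrite leey|by []..].
by rewrite lee_fin; split=> /RleP.
Qed.

Lemma to_bar_epsum f n : to_bar (epsum f n) = (\sum_(k < n) to_bar (f k))%E.
Proof.
by elim: n => [|n IHn]; rewrite ?big_ord0// big_ord_recr/= to_bar_eadd IHn.
Qed.

Lemma continuous_valuation_to_bar (X : Type) (T : topology X)
    (nu : (X -> Prop) -> Defs.ereal) :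
  continuous_valuation T nu -> valuation T (to_bar \o nu).
Proof.
move=> [nu_ge0 [nu0 [nuM nuD]]].
have nu_directed D : directed_open_family T D ->
    is_elub (fun a => exists U, D U /\ a = nu U) (nu (\bigcup_(U in D) U)).
  move=> /nuD; congr (is_elub _ (nu _)); apply/predeqP => x.
  by split=> [[U [DU Ux]]|[U DU Ux]]; exists U.
split=> [U /nu_ge0 /ele_to_bar//| |U V oU oV|U V oU oV UV|D y dD Dy] /=.
- by rewrite -[set0]/(@empty_set X) nu0.
- by rewrite -!to_bar_eadd; congr to_bar; exact: nuM.
(* Monotonicity is Scott continuity on the directed pair [U], [V], whose union is [V]. *)
- have [|+ _] := nu_directed [set U; V].
    split; first by move=> _ [->|->].
    split; first by exists U; left.
    by move=> _ _ [->|->] [->|->]; exists V; do !split=> //; right.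
  rewrite bigcup_setU !bigcup_set1 (setUidr UV) => /(_ (nu U)) UleV.
  by apply/ele_to_bar/UleV; exists U; split=> //; left.
have [_ lubD] := nu_directed D dD.
case: y Dy => [r| |] Dy; last 2 first.
- exact: leey.
- by have [_ [[U DU] _]] := dD; have := Dy U DU; rewrite /=; case: (nu U).
suff /ele_to_bar : ele (nu (\bigcup_(U in D) U)) (Defs.EFin r) by [].
by apply: lubD => _ [U [DU ->]]; apply/ele_to_bar; exact: Dy.
Qed.

(** * Borel measures from outer measures *)

Lemma borel_caratheodory (R : realType) (X : Type) (T : topology X)
    (mu : {outer_measure set X -> \bar R}) :
  open T `<=` mu.-caratheodory -> borel T `<=` mu.-caratheodory.
Proof.
move=> oT B; apply=> //; split; first exact: caratheodory_measurable_set0.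
split; first exact: caratheodory_measurable_setC.
move=> F mF; have := caratheodory_measurable_bigcup mF.
congr (_ _); apply/predeqP => x.
by split=> [[n _ Fx]|[n Fx]]; exists n.
Qed.

Lemma borel_measure_caratheodory (X : Type) (T : topology X)
    (mu : {outer_measure set X -> \bar Rdefinitions.R}) :
  open T `<=` mu.-caratheodory -> borel_measure T (of_bar \o mu).
Proof.
move=> oT; split=> [B _|].
  by apply/ele_to_bar; rewrite /= of_barK ?outer_measure_ge0.
split=> [|F bF dF].
  by rewrite /= -[empty_set]/(@set0 X) outer_measure0.
have mF k : mu.-caratheodory (F k) by exact: (borel_caratheodory oT).
rewrite (_ : (fun x => exists n, F n x) = \bigcup_n F n); last first.
  by apply/predeqP => x; split=> [[n Fx]|[n _ Fx]]; exists n.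
have tF : trivIset setT F.
  apply/trivIsetP => i j _ _ /eqP ij; apply/seteqP; split=> // x [Fi Fj].
  exact: dF ij Fi Fj.
(* Subadditivity gives one inequality; the other is the Caratheodory inequality tested on the union
   itself. *)
have sumF : (mu (\bigcup_n F n) = \sum_(k <oo) mu (F k))%E.
  apply/eqP; rewrite eq_le outer_measure_sigma_subadditive/=.
  have := caratheodory_lime_le mF tF (\bigcup_n F n).
  rewrite setICr outer_measure0 adde0; congr (_ <= _)%E.
  apply: eq_eseriesr => k _; congr (mu _); apply: setIidr.
  exact: bigcup_sup.
have psum n : to_bar (epsum (fun k => (of_bar \o mu) (F k)) n) =
    (\sum_(0 <= k < n) mu (F k))%E.
  rewrite to_bar_epsum big_mkord; apply: eq_bigr => k _.
  by rewrite /= of_barK ?outer_measure_ge0.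
split=> [_ [n ->]|b Fb]; apply/ele_to_bar.
  rewrite psum /= of_barK ?outer_measure_ge0// sumF.
  by apply: nneseries_lim_ge => k _ _; exact: outer_measure_ge0.
rewrite /= of_barK ?outer_measure_ge0// sumF; apply: lime_le.
  by apply: is_cvg_nneseries => k _ _; exact: outer_measure_ge0.
by apply: nearW => n; rewrite -psum; apply/ele_to_bar/Fb; exists n.
Qed.

Theorem theorem1 (X : Type) (T : topology X) :
  LCS_complete T ->
  forall nu : (X -> Prop) -> ereal, continuous_valuation T nu ->
  exists mu : (X -> Prop) -> ereal,
    borel_measure T mu /\ (forall U, open T U -> mu U = nu U).
Proof.
move=> lcsX nu cv_nu; have val_nu := continuous_valuation_to_bar cv_nu.
(* The outer measure is built over a pointed type, so the empty space is treated apart. *)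
have [[x0 _]|X0] := pselect (exists x : X, True).
  have [|mu [oT muE]] := valuation_extends_outer val_nu x0.
    by move=> O U V; exact: LCS_crescent_subadditive.
  exists (of_bar \o mu); split; first exact: borel_measure_caratheodory.
  by move=> U oU; rewrite /= muE//= to_barK.
(* On the empty space every set equals [empty_set], and the constant [nu empty_set], which is 0, is
   a measure. *)
have [_ [nu0 _]] := cv_nu; exists (fun=> nu empty_set); split; last first.
  by move=> U _; congr nu; apply/predeqP => x; case: X0; exists x.
split=> [B _|]; first by rewrite nu0; exact/ele_to_bar.
split=> // F _ _; split=> [_ [n ->]|b /(_ (nu empty_set))]; last first.
  by apply; exists 0%N.
by apply/ele_to_bar; rewrite to_bar_epsum nu0 big1.
Qed.
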